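(* Let $G$ be a connected graph on $n$ vertices. Then $$SW(G)=\sum_{v\in V(G)}B_S(v)+2^{n-1}(n-2)+1.$$
   Context: All graphs are finite, simple and undirected. For a connected graph $G$ and $S\subseteq V(G)$, the Steiner diversity $\delta(S)$ is the minimum number of edges of a connected subgraph of $G$ whose vertex set contains $S$. A connected subgraph of $G$ whose vertex set contains $S$ and which has exactly $\delta(S)$ edges is a tree, called a Steiner tree on $S$. The vertices in $S$ are its terminal vertices; its other vertices are its non-terminal vertices. The total Steiner Wiener index of $G$ is $SW(G)=\sum_{S\subseteq V(G),\,|S|\ge 2}\delta(S)$. The total Steiner betweenness centrality of a vertex $v\in V(G)$ is $$B_S(v)=\sum_{\substack{A\subseteq V(G)\setminus\{v\}\\ |A|\ge 2}}\frac{\sigma_A(v)}{\sigma_A},$$ where $\sigma_A$ is the number of all Steiner trees on $A$ in $G$ and $\sigma_A(v)$ is the number of all Steiner trees on $A$ in $G$ that include $v$ as a non-terminal vertex. (The subscript $S$ in $B_S$ is just notation, standing for ''Steiner''.) *)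

(* Defs.v *)
From HB Require Import structures.
From mathcomp Require Import all_boot all_order all_algebra.

Set Implicit Arguments.
Unset Strict Implicit.
Unset Printing Implicit Defensive.

Import GRing.Theory.

Record sgraph := SGraph {
  svertex :> finType;
  sedge : rel svertex;
  sedge_sym : symmetric sedge;
  sedge_irrefl : irreflexive sedge
}.

Definition edges (G : sgraph) : {set {set G}} :=
  [set f | [exists x : G, exists y : G, sedge x y && (f == [set x; y])]].

(* A candidate subgraph is a pair (vertex set, edge set); see is_subgraph. *)
Definition pregraph (G : sgraph) : finType := ({set G} * {set {set G}})%type.

Definition whole (G : sgraph) : pregraph G := ([set: G], edges G).

Definition is_subgraph (G : sgraph) (H : pregraph G) : bool :=
  (H.2 \subset edges G) && [forall f in H.2, f \subset H.1].

Definition sub_adj (G : sgraph) (H : pregraph G) : rel G :=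
  fun x y => [set x; y] \in H.2.

(* The null graph is not connected. *)
Definition sub_connected (G : sgraph) (H : pregraph G) : bool :=
  (H.1 != set0) && [forall x in H.1, forall y in H.1, connect (sub_adj H) x y].

Definition connected_graph (G : sgraph) : bool := sub_connected (whole G).

Definition conn_subgraph_on (G : sgraph) (S : {set G}) (H : pregraph G) : bool :=
  [&& is_subgraph H, sub_connected H & S \subset H.1].

(* If G is connected, whole G is a connected subgraph containing S, so this is
   a genuine minimum. *)
Definition steiner_div (G : sgraph) (S : {set G}) : nat :=
  #|([arg min_(H < whole G | conn_subgraph_on S H) #|H.2|]).2|.

Definition steiner_tree (G : sgraph) (S : {set G}) (H : pregraph G) : bool :=
  conn_subgraph_on S H && (#|H.2| == steiner_div S).

Definition steiner_wiener (G : sgraph) : nat :=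
  \sum_(S : {set G} | 2 <= #|S|) steiner_div S.

Definition nb_steiner (G : sgraph) (A : {set G}) : nat :=
  #|[set H : pregraph G | steiner_tree A H]|.

Definition nb_steiner_through (G : sgraph) (A : {set G}) (v : G) : nat :=
  #|[set H : pregraph G | steiner_tree A H & v \in H.1 :\: A]|.

Definition steiner_betweenness (G : sgraph) (v : G) : rat :=
  (\sum_(A : {set G} | (A \subset [set~ v]) && (2 <= #|A|)%N)
     (nb_steiner_through A v)%:R / (nb_steiner A)%:R)%R.

(* Main.v *)
Require Import Defs.
From HB Require Import structures.
From mathcomp Require Import all_boot all_order all_algebra.
From mathcomp Require Import ring lra.

Set Implicit Arguments.
Unset Strict Implicit.
Unset Printing Implicit Defensive.

Import GRing.Theory.
Local Open Scope ring_scope.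

(** The identity is a double count.  A Steiner tree on [A] is a connected
    subgraph with the least number of edges; since every connected subgraph
    has a spanning tree ([spanning_tree]), a Steiner tree on [A] has exactly
    [delta(A) + 1] vertices ([card_steiner_tree]), hence
    [delta(A) + 1 - #|A|] non-terminal ones.  Exchanging the sums over
    vertices and over Steiner trees, the ratios [sigma_A(v) / sigma_A] for a
    fixed [A] add up to [delta(A) + 1 - #|A|] ([sum_steiner_ratio]).  Summing
    over [A], the difference between [SW(G)] and the total betweenness is the
    sum of [#|A| - 1] over all [A] with at least two elements, which is
    [2^(n-1) (n-2) + 1] ([sum_card_pred]). *)

(** * Spanning trees *)

Section Trees.
Local Open Scope nat_scope.
Variable G : sgraph.
Implicit Types (H : pregraph G) (A U : {set G}).

Lemma sub_connect_sym H : connect_sym (sub_adj H).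
Proof. by apply: sym_connect_sym => x y; rewrite /sub_adj setUC. Qed.

Lemma sub_connectedP H :
  reflect (H.1 != set0 /\ {in H.1 &, forall x y, connect (sub_adj H) x y})
          (sub_connected H).
Proof.
apply: (iffP andP) => -[nzH cH]; split=> //.
  by move=> x y xH yH; move/forall_inP/(_ x xH)/forall_inP: cH => ->.
by apply/forall_inP=> x xH; apply/forall_inP=> y yH; apply: cH.
Qed.

(** A vertex set that meets a connected subgraph without exhausting it is left
    by an edge of the subgraph. *)
Lemma boundary_edge H U :
    is_subgraph H -> sub_connected H -> U != set0 -> U \proper H.1 ->
  exists u w, [/\ u \in U, w \in H.1 :\: U & [set u; w] \in H.2].
Proof.
move=> /andP[_ /forall_inP sH] /sub_connectedP[_ cH].
move=> /set0Pn[x xU] /properP[sUH [y yH yNU]].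
have [/existsP[u /existsP[w /and3P[uU wNU uw]]]|noedge] :=
  boolP [exists u, exists w, [&& u \in U, w \notin U & sub_adj H u w]].
  exists u, w; split=> //; rewrite inE wNU.
  by apply: (subsetP (sH _ uw)); rewrite set22.
have clU : closed (sub_adj H) (mem U).
  apply: (intro_closed (sub_connect_sym H)) => u w uw uU.
  apply: contraNT noedge => wNU.
  by apply/existsP; exists u; apply/existsP; exists w; apply/and3P.
have := closed_connect clU (cH x y (subsetP sUH x xU) yH).
by rewrite /= xU (negbTE yNU).
Qed.

(** Attaching a new vertex by a single edge preserves connectedness. *)
Lemma add_leaf H u w :
    is_subgraph H -> sub_connected H -> u \in H.1 -> w \notin H.1 ->
    [set u; w] \in edges G ->
  let H' := (w |: H.1, [set u; w] |: H.2) in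
  [/\ is_subgraph H', sub_connected H' & #|H'.2| = #|H.2|.+1].
Proof.
move=> /andP[eH /forall_inP sH] /sub_connectedP[_ cH] uH wNH uwG /=.
have uwNH : [set u; w] \notin H.2.
  by apply: contra wNH => /sH/subsetP; apply; rewrite set22.
split; last by rewrite cardsU1 uwNH.
  apply/andP; split=> /=; first by rewrite subUset sub1set uwG.
  apply/forall_inP=> f; rewrite !inE => /predU1P[->|/sH sfH].
    by rewrite subUset !sub1set !inE uH eqxx orbT.
  exact: subset_trans sfH (subsetU1 _ _).
set H' := (_, _).
have toU x : x \in H'.1 -> connect (sub_adj H') x u.
  rewrite /= !inE => /predU1P[->|xH].
    by rewrite sub_connect_sym connect1 // /sub_adj /= setU11.
  apply: connect_sub (cH x u xH uH) => y z yz; apply: connect1.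
  by rewrite /sub_adj /= inE (yz : _ \in H.2) orbT.
apply/sub_connectedP; split; first by apply/set0Pn; exists w; rewrite setU11.
move=> x y /toU xu /toU yu; apply: connect_trans xu _.
by rewrite sub_connect_sym.
Qed.

(** A connected subgraph contains subtrees with any number of vertices, from
    one up to the number of its own: start from
    a single vertex and cross the boundary edge by edge. *)
Lemma grow_subtree H k :
    is_subgraph H -> sub_connected H -> k < #|H.1| ->
  exists T : pregraph G, [/\ is_subgraph T, sub_connected T,
    T.1 \subset H.1, T.2 \subset H.2 & #|T.1| = k.+1 /\ #|T.2| = k].
Proof.
move=> sgH cH; elim: k => [|k IHk] ltkH.
  have [/set0Pn[x xH] _] := sub_connectedP H cH.
  exists ([set x], set0); split=> /=; rewrite ?sub1set ?sub0set ?cards1 ?cards0 //.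
    by rewrite /is_subgraph sub0set; apply/forall_inP=> f; rewrite inE.
  apply/sub_connectedP; split; first by rewrite -card_gt0 cards1.
  by move=> y z /set1P-> /set1P->.
have [T [sgT cT sT1 sT2 [n1 n2]]] := IHk (ltnW ltkH).
have pT : T.1 \proper H.1 by rewrite properEcard sT1 n1.
have nzT : T.1 != set0 by rewrite -card_gt0 n1.
have [u [w [uT /setDP[wH wNT] uw]]] := boundary_edge sgH cH nzT pT.
have uwG : [set u; w] \in edges G by case/andP: sgH => /subsetP->.
have [sgT' cT' n2'] := add_leaf sgT cT uT wNT uwG.
exists (w |: T.1, [set u; w] |: T.2); split=> //=.
- by rewrite subUset sub1set wH.
- by rewrite subUset sub1set uw.
- by rewrite cardsU1 wNT n1 n2' n2.
Qed.

Lemma spanning_tree H :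
    is_subgraph H -> sub_connected H ->
  exists F : {set {set G}}, [/\ is_subgraph (H.1, F), sub_connected (H.1, F),
    F \subset H.2 & #|H.1| = #|F|.+1].
Proof.
move=> sgH cH; have [nzH _] := sub_connectedP H cH.
have n1H : #|H.1|.-1.+1 = #|H.1| by rewrite prednK // card_gt0.
have [|[T1 T2] /= [sgT cT sT1 sT2 [n1 n2]]] := @grow_subtree H #|H.1|.-1 sgH cH.
  by rewrite n1H.
have eT1 : T1 = H.1 by apply/eqP; rewrite eqEcard sT1 n1 n1H /=.
by exists T2; rewrite -eT1 n1 n2.
Qed.

(** * Steiner trees *)

Section Connected.
Hypothesis cG : connected_graph G.

Lemma conn_subgraph_on_whole A : conn_subgraph_on A (whole G).
Proof.
apply/and3P; split=> //; last exact: subsetT.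
by rewrite /is_subgraph subxx; apply/forall_inP=> f _; apply: subsetT.
Qed.

Lemma steiner_div_min A H : conn_subgraph_on A H -> steiner_div A <= #|H.2|.
Proof.
rewrite /steiner_div; case: arg_minnP => [|T _ minT]; last exact: minT.
exact: conn_subgraph_on_whole.
Qed.

Lemma nb_steiner_gt0 A : 0 < nb_steiner A.
Proof.
rewrite card_gt0; apply/set0Pn.
exists [arg min_(H < whole G | conn_subgraph_on A H) #|H.2|].
rewrite inE /steiner_tree eqxx andbT.
by case: arg_minnP => //; apply: conn_subgraph_on_whole.
Qed.

(** By minimality a Steiner tree has no more edges than a spanning tree of
    itself, so it has one vertex more than it has edges. *)
Lemma card_steiner_tree A H : steiner_tree A H -> #|H.1| = (steiner_div A).+1.
Proof.
move=> /andP[/and3P[sgH cH sAH] /eqP n2].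
have [F [sgF cF sF ->]] := spanning_tree sgH cH; congr _.+1.
(* F lies among the edges of H, and is itself a candidate for the minimum *)
apply/eqP; rewrite eqn_leq -{1}n2 subset_leq_card //=.
exact: (@steiner_div_min A (H.1, F) (introT and3P (And3 sgF cF sAH))).
Qed.

(** Counting the pairs of a Steiner tree on [A] and one of its non-terminal
    vertices. *)
Lemma sum_nb_steiner_through A :
  \sum_(v | v \notin A) nb_steiner_through A v
    = nb_steiner A * ((steiner_div A).+1 - #|A|).
Proof.
have -> : \sum_(v | v \notin A) nb_steiner_through A v
    = \sum_(v | v \notin A) \sum_(H | steiner_tree A H) (v \in H.1 :\: A).
  apply: eq_bigr => v _; rewrite /nb_steiner_through -sum1dep_card.
  by rewrite big_mkcondr; apply: eq_bigr => H _; case: (v \in _).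
rewrite exchange_big /= /nb_steiner -sum1dep_card big_distrl /=.
apply: eq_bigr => H tH; rewrite mul1n -(card_steiner_tree tH).
have sAH : A \subset H.1 by case/andP: tH => /and3P[].
rewrite -(cardsDS sAH) -sum1_card big_mkcond [RHS]big_mkcond /=.
by apply: eq_bigr => v _; rewrite !inE; case: (v \in A); case: (v \in H.1).
Qed.

Lemma leq_card_steiner_div A : #|A| <= (steiner_div A).+1.
Proof.
have := nb_steiner_gt0 A; rewrite card_gt0 => /set0Pn[H]; rewrite inE => tH.
rewrite -(card_steiner_tree tH) subset_leq_card //.
by case/andP: tH => /and3P[].
Qed.

Lemma sum_steiner_ratio A :
  (\sum_(v | v \notin A) (nb_steiner_through A v)%:R / (nb_steiner A)%:R
     = (steiner_div A)%:R + 1 - #|A|%:R :> rat)%R.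
Proof.
rewrite -mulr_suml -natr_sum sum_nb_steiner_through natrM mulrC mulKf.
  by rewrite natrB ?leq_card_steiner_div // -addn1 natrD.
by rewrite Num.Theory.pnatr_eq0 -lt0n nb_steiner_gt0.
Qed.

End Connected.
End Trees.

(** * Counting over subsets *)

(** Pairing each subset with its complement. *)
Lemma sum_card_sets (T : finType) :
  2 * \sum_(A : {set T}) #|A|%:R = #|T|%:R * 2 ^+ #|T| :> rat.
Proof.
have cA : \sum_(A : {set T}) #|A|%:R = \sum_(A : {set T}) #|~: A|%:R :> rat.
  by rewrite (reindex_inj (@setC_inj T)).
rewrite mulr_natl mulr2n {2}cA -big_split /=.
under eq_bigr => A _ do rewrite -natrD cardsC.
rewrite sumr_const -[#|_|]cardsT -powersetT card_powerset cardsT.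
by rewrite -[LHS]mulr_natr natrX.
Qed.

Lemma sum_card_pred (T : finType) : (0 < #|T|)%N ->
  \sum_(A : {set T} | (2 <= #|A|)%N) (#|A|%:R - 1)
    = 2 ^+ #|T|.-1 * (#|T|%:R - 2) + 1 :> rat.
Proof.
move=> T_gt0; have sumT := sum_card_sets T.
have small : \sum_(A : {set T} | ~~ (2 <= #|A|)%N) (#|A|%:R - 1) = -1 :> rat.
  (* singletons contribute 0, so only the empty set remains *)
  rewrite (bigD1 set0) ?cards0 //= big1 ?addr0 ?sub0r // => A /andP[leA nzA].
  suff -> : #|A| = 1%N by rewrite subrr.
  by apply/eqP; rewrite eqn_leq card_gt0 nzA andbT -ltnS ltnNge.
have : \sum_(A : {set T}) (#|A|%:R - 1) = \sum_(A : {set T}) #|A|%:R - 2 ^+ #|T| :> rat.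
  rewrite sumrB; congr (_ - _).
  by rewrite sumr_const -[#|_|]cardsT -powersetT card_powerset cardsT natrX.
rewrite (bigID (fun A : {set T} => (2 <= #|A|)%N)) /= small.
move: sumT; rewrite -{2 3}(prednK T_gt0) exprS => sumT.
lra.
Qed.

Theorem theorem7 (G : sgraph) (n : nat) (hn : #|G| = n)
    (hG : connected_graph G) :
  (steiner_wiener G)%:R =
    \sum_(v : G) steiner_betweenness v
    + 2%:R ^+ n.-1 * (n%:R - 2%:R) + 1 :> rat.
Proof.
have n_gt0 : (0 < #|G|)%N.
  by case/andP: hG => /set0Pn[x _] _; apply/card_gt0P; exists x.
rewrite -addrA -hn -sum_card_pred // /steiner_betweenness.
rewrite (exchange_big_dep (fun A : {set G} => (2 <= #|A|)%N)) /=; last first.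
  by move=> v A _ /andP[].
rewrite -big_split /steiner_wiener natr_sum /=; apply: eq_bigr => A A2.
rewrite (eq_bigl (fun v => v \notin A)) => [|v]; last first.
  by rewrite A2 andbT subsetC sub1set inE.
by rewrite sum_steiner_ratio //; ring.
Qed.
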